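(* Let $T_n$ denote the total number of strict left to right maxima, summed over all Dyck paths of semi-length $n$, and let $\mathrm{Tot}=\sum_{n\ge 1}T_n z^{2n}$. Then, with $u$ the power series in $z$ defined by $u=\frac{1-2z^2-\sqrt{1-4z^2}}{2z^2}$ (so that $z^2=\frac{u}{(1+u)^2}$), \[ \mathrm{Tot}=\sum_{r=1}^\infty \frac{(1-u)^2 u^r (1+u)}{(1-u^{1+r})(1-u^{2+r})}\left(r-\sum_{i=1}^{r-1}\frac{1-u^{2+i}}{(1+u)(1-u^{1+i})}\right). \]
   Context: A Dyck path of semi-length $n$ is a lattice path from $(0,0)$ to $(2n,0)$ with $n$ up steps $(1,1)$ and $n$ down steps $(1,-1)$ never going below the $x$-axis. A peak is an up step immediately followed by a down step, and its height is the height of its top point. A strict left to right maximum is a peak whose height is strictly greater than the heights of all peaks to its left. *)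

(* Defs.v *)
From HB Require Import structures.
From mathcomp Require Import all_boot all_order all_algebra.
From mathcomp Require Import boolp.
From mathcomp Require Import zify.

Set Implicit Arguments.
Unset Strict Implicit.
Unset Printing Implicit Defensive.

Import Order.TTheory GRing.Theory Num.Theory.
Local Open Scope ring_scope.

Record fps (R : Type) := Fps { fcoef : nat -> R }.

Notation "{ 'fps' R }" := (fps R) (at level 0, format "{ 'fps'  R }").

HB.instance Definition _ (R : Type) := gen_eqMixin {fps R}.
HB.instance Definition _ (R : Type) := gen_choiceMixin {fps R}.

Lemma fpsP (R : Type) (p q : {fps R}) : (forall n, fcoef p n = fcoef q n) <-> p = q.
Proof.
split=> [|-> //]; case: p q => [p] [q] /= pq.
by congr Fps; apply/funext.
Qed.

(* Course-of-values recursion: the n-th coefficient is F applied to the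
   sequence of the first n coefficients. *)
Section Recursion.
Variables (R : nzRingType) (F : seq R -> R).

Fixpoint rec_seq (n : nat) : seq R :=
  if n is m.+1 then rcons (rec_seq m) (F (rec_seq m)) else [::].

Definition fps_rec : {fps R} := Fps (fun n => F (rec_seq n)).

Lemma size_rec_seq n : size (rec_seq n) = n.
Proof. by elim: n => //= n IHn; rewrite size_rcons IHn. Qed.

Lemma nth_rec_seq n i : (i < n)%N -> (rec_seq n)`_i = fcoef fps_rec i.
Proof.
elim: n => // n IHn; rewrite ltnS leq_eqVlt /= nth_rcons size_rec_seq.
by case/orP=> [/eqP->|lt_in]; rewrite ?ltnn ?eqxx // lt_in IHn.
Qed.

End Recursion.

Section Ring.
Variable R : comUnitRingType.
Implicit Types p q r : {fps R}.

Definition fps_zero : {fps R} := Fps (fun=> 0).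
Definition fps_opp p : {fps R} := Fps (fun n => - fcoef p n).
Definition fps_add p q : {fps R} := Fps (fun n => fcoef p n + fcoef q n).
Definition fps_one : {fps R} := Fps (fun n => (n == 0%N)%:R).
Definition fps_mul p q : {fps R} :=
  Fps (fun n => \sum_(i < n.+1) fcoef p i * fcoef q (n - i)).

Fact fps_addA : associative fps_add.
Proof. by move=> p q r; apply/fpsP => n /=; rewrite addrA. Qed.
Fact fps_addC : commutative fps_add.
Proof. by move=> p q; apply/fpsP => n /=; rewrite addrC. Qed.
Fact fps_add0 : left_id fps_zero fps_add.
Proof. by move=> p; apply/fpsP => n /=; rewrite add0r. Qed.
Fact fps_addN : left_inverse fps_zero fps_opp fps_add.
Proof. by move=> p; apply/fpsP => n /=; rewrite addNr. Qed.

HB.instance Definition _ :=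
  GRing.isZmodule.Build {fps R} fps_addA fps_addC fps_add0 fps_addN.

Let trunc n p : {poly R} := \poly_(i < n.+1) fcoef p i.

Let coef_trunc n p k : (k <= n)%N -> (trunc n p)`_k = fcoef p k.
Proof. by move=> le_kn; rewrite coef_poly ltnS le_kn. Qed.

Let coef_mul_trunc n p q k :
  (k <= n)%N -> fcoef (fps_mul p q) k = (trunc n p * trunc n q)`_k.
Proof.
move=> le_kn; rewrite coefM; apply: eq_bigr => i _ /=.
rewrite !coef_trunc //; first exact: leq_trans (leq_subr _ _) le_kn.
by apply: leq_trans le_kn; rewrite -ltnS.
Qed.

Fact fps_mulC : commutative fps_mul.
Proof. by move=> p q; apply/fpsP => n; rewrite !(coef_mul_trunc _ _ (leqnn n)) mulrC. Qed.

Fact fps_mulA : associative fps_mul.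
Proof.
move=> p q r; apply/fpsP => n.
transitivity ((trunc n p * (trunc n q * trunc n r))`_n).
  rewrite coefM; apply: eq_bigr => i _.
  by rewrite coef_trunc ?leq_ord // -coef_mul_trunc // leq_subr.
rewrite mulrA coefM; apply: eq_bigr => i _.
by rewrite -coef_mul_trunc ?leq_ord // coef_trunc // leq_subr.
Qed.

Fact fps_mul1 : left_id fps_one fps_mul.
Proof.
move=> p; apply/fpsP => n /=.
rewrite big_ord_recl /= mul1r subn0 big1 ?addr0 // => i _.
by rewrite /bump /= mul0r.
Qed.

Fact fps_mulDl : left_distributive fps_mul fps_add.
Proof.
move=> p q r; apply/fpsP => n /=; rewrite -big_split /=.
by apply: eq_bigr => i _; rewrite mulrDl.
Qed.

Fact fps_one_neq0 : fps_one != 0.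
Proof.
apply/eqP => /fpsP /(_ 0%N) /= /eqP.
by rewrite oner_eq0.
Qed.

HB.instance Definition _ := GRing.Zmodule_isComNzRing.Build {fps R}
  fps_mulA fps_mulC fps_mul1 fps_mulDl fps_one_neq0.

Lemma fcoef0 n : fcoef (0 : {fps R}) n = 0. Proof. by []. Qed.
Lemma fcoef1 n : fcoef (1 : {fps R}) n = (n == 0%N)%:R. Proof. by []. Qed.
Lemma fcoefD p q n : fcoef (p + q) n = fcoef p n + fcoef q n. Proof. by []. Qed.
Lemma fcoefN p n : fcoef (- p) n = - fcoef p n. Proof. by []. Qed.
Lemma fcoefB p q n : fcoef (p - q) n = fcoef p n - fcoef q n. Proof. by []. Qed.
Lemma fcoefM p q n :
  fcoef (p * q) n = \sum_(i < n.+1) fcoef p i * fcoef q (n - i).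
Proof. by []. Qed.

Lemma fcoef_sum I (s : seq I) (P : pred I) (f : I -> {fps R}) n :
  fcoef (\sum_(i <- s | P i) f i) n = \sum_(i <- s | P i) fcoef (f i) n.
Proof. by apply: (big_morph (fun p : {fps R} => fcoef p n)). Qed.

Lemma fcoefMn p m n : fcoef (p *+ m) n = fcoef p n *+ m.
Proof. by elim: m => // m IHm; rewrite !mulrS fcoefD IHm. Qed.

Definition fps_unit : pred {fps R} := fun p => fcoef p 0 \is a GRing.unit.

Definition fps_inv p : {fps R} :=
  if fps_unit p then
    fps_rec (fun s => (((size s == 0)%N)%:R
      - \sum_(i < size s) fcoef p (size s - i) * s`_i) / fcoef p 0)
  else p.

Fact fps_mulVr : {in fps_unit, left_inverse 1 fps_inv *%R}.
Proof.
move=> p pU; apply/fpsP => n; have {}pU : fps_unit p := pU.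
rewrite /fps_inv pU fcoefM big_ord_recr /= subnn size_rec_seq divrK //.
set S := (X in X + _); set S' := (X in _ - X); suff -> : S = S' by rewrite addrC subrK.
by apply: eq_bigr => i _; rewrite nth_rec_seq // mulrC.
Qed.

Fact fps_unitP p q : q * p = 1 -> fps_unit p.
Proof.
move=> /fpsP /(_ 0%N); rewrite fcoefM big_ord_recl big_ord0 addr0 /= => qp1.
by apply/unitrP; exists (fcoef q 0); split; rewrite // mulrC.
Qed.

Fact fps_inv_out : {in [predC fps_unit], fps_inv =1 id}.
Proof.
by move=> p pNU; have {}pNU : ~~ fps_unit p := pNU; rewrite /fps_inv (negbTE pNU).
Qed.

HB.instance Definition _ := GRing.ComNzRing_hasMulInverse.Build {fps R}
  fps_mulVr fps_unitP fps_inv_out.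

Lemma fps_unitE p : (p \is a GRing.unit) = (fcoef p 0 \is a GRing.unit).
Proof. by []. Qed.

Definition fpsX : {fps R} := Fps (fun n => (n == 1%N)%:R).

Lemma fcoefXnM k p n :
  fcoef (fpsX ^+ k * p) n = if (n < k)%N then 0 else fcoef p (n - k).
Proof.
elim: k n => [|k IHk] n; first by rewrite mul1r subn0.
rewrite exprS -mulrA; move: (fpsX ^+ k * p) IHk => q IHq.
rewrite fcoefM big_ord_recl mul0r add0r; case: n => [|n]; first by rewrite big_ord0.
rewrite big_ord_recl mul1r big1 => [|i _]; last by rewrite mul0r.
by rewrite addr0 IHq /= !subSS subn0.
Qed.

(* The quotient of p by X^k; it is exact when the first k coefficients of p
   vanish, which is the only case in which it is meant to be used. *)
Definition fps_divXn (k : nat) p : {fps R} := Fps (fun n => fcoef p (k + n)).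

Lemma fps_divXnK k p :
  (forall i, (i < k)%N -> fcoef p i = 0) -> fpsX ^+ k * fps_divXn k p = p.
Proof.
move=> p0; apply/fpsP => n; rewrite fcoefXnM.
by case: ltnP => [/p0->|le_kn] //=; rewrite subnKC.
Qed.

(* The square root of constant coefficient 1 of a series p of constant
   coefficient 1, when 2 is invertible in R. *)
Definition fps_sqrt p : {fps R} :=
  fps_rec (fun s => if size s is n.+1 then
    (fcoef p n.+1 - \sum_(i < n) s`_i.+1 * s`_(n - i)) / 2 else 1).

Lemma fcoef_sqrt0 p : fcoef (fps_sqrt p) 0 = 1.
Proof. by []. Qed.

Lemma fcoef_sqrtS p n : fcoef (fps_sqrt p) n.+1 = (fcoef p n.+1 -
  \sum_(i < n) fcoef (fps_sqrt p) i.+1 * fcoef (fps_sqrt p) (n - i)) / 2.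
Proof.
rewrite {1}/fps_sqrt [LHS]/= -/(rec_seq _ n.+1) size_rec_seq.
congr ((_ - _) / _); apply: eq_bigr => i _.
by rewrite !nth_rec_seq // ltnS ?leq_subr.
Qed.

Lemma fps_sqrtK p :
  (2 : R) \is a GRing.unit -> fcoef p 0 = 1 -> fps_sqrt p ^+ 2 = p.
Proof.
move=> U2 p0; apply/fpsP => -[|n]; rewrite expr2 fcoefM.
  by rewrite big_ord_recl big_ord0 addr0 subn0 fcoef_sqrt0 mulr1 p0.
rewrite big_ord_recr big_ord_recl subnn subn0 fcoef_sqrt0 mul1r mulr1.
rewrite fcoef_sqrtS.
set S := (X in _ - X); set y := _ / 2.
have y2 : y + y = fcoef p n.+1 - S by rewrite -mulr2n -mulr_natr divrK.
set S' := \big[_/_]_(i < n) _; have -> : S' = S by apply: eq_bigr.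
by rewrite -[LHS]/(y + S + y) addrAC y2 subrK.
Qed.

(* \sum_(r >= 1) f r = s in the formal topology: every coefficient of the
   partial sums is eventually equal to the one of s. *)
Definition fps_sum_from1 (f : nat -> {fps R}) (s : {fps R}) : Prop :=
  forall n : nat, exists N : nat, forall M : nat, (N <= M)%N ->
    fcoef (\sum_(1 <= r < M.+1) f r) n = fcoef s n.

Lemma fps_sum_from1_unique f s t :
  fps_sum_from1 f s -> fps_sum_from1 f t -> s = t.
Proof.
move=> fs ft; apply/fpsP => n; have [N sN] := fs n; have [N' tN] := ft n.
by rewrite -(sN _ (leq_maxl N N')) tN // leq_maxr.
Qed.

End Ring.

Arguments fpsX {R}.

(* A lattice path is its word of steps: true is the up step (1,1) and false
   is the down step (1,-1). *)
Definition height (w : seq bool) (k : nat) : int :=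
  (count_mem true (take k w))%:Z - (count_mem false (take k w))%:Z.

Definition dyck (n : nat) (w : (2 * n).-tuple bool) : bool :=
  [&& count_mem true w == n, count_mem false w == n
    & [forall k : 'I_(2 * n).+1, 0 <= height w k]].

(* Peaks are indexed by the abscissa k > 0 of their top point. *)
Definition peak (w : seq bool) (k : nat) : bool :=
  [&& 0 < k, k < size w, nth false w k.-1 & ~~ nth true w k]%N.

Definition strict_lr_max (w : seq bool) (k : nat) : bool :=
  peak w k && [forall j : 'I_k, peak w j ==> (height w j < height w k)].

Definition nb_strict_lr_max (n : nat) (w : (2 * n).-tuple bool) : nat :=
  #|[set k : 'I_(2 * n) | strict_lr_max w k]|.

Definition total_lr_max (n : nat) : nat :=
  \sum_(w : (2 * n).-tuple bool | dyck w) nb_strict_lr_max w.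

Definition Tot : {fps rat} :=
  Fps (fun m => if ~~ odd m && (0 < m)%N then (total_lr_max m./2)%:R else 0).

Lemma Tot_sum : fps_sum_from1 (fun n => (total_lr_max n)%:R * fpsX ^+ (2 * n)) Tot.
Proof.
have cf n m : fcoef ((total_lr_max n)%:R * fpsX ^+ (2 * n) : {fps rat}) m
    = if m == (2 * n)%N then (total_lr_max n)%:R else 0.
  rewrite mulrC fcoefXnM fcoefMn fcoef1 subn_eq0.
  by case: ltngtP; rewrite ?mul0rn.
move=> m; exists m => M le_mM; rewrite fcoef_sum.
under eq_bigr => n _ do rewrite cf.
rewrite [RHS]/=; case: ifP => [/andP[m_even m_gt0] | m_bad].
  have Dm : m = (2 * m./2)%N by rewrite mul2n -[LHS]odd_double_half (negbTE m_even).
  rewrite (bigD1_seq m./2) ?iota_uniq //=; last first.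
    rewrite mem_index_iota ltnS; apply/andP; split; first by lia.
    by apply: leq_trans le_mM; rewrite {2}Dm leq_pmull.
  rewrite -Dm eqxx big1 ?addr0 // => n /negbTE n_ne; case: eqP => // mn.
  by rewrite mn mul2n doubleK eqxx in n_ne.
rewrite big_nat_cond big1 // => n; rewrite andbT => /andP[n_gt0 _].
case: eqP => // mn; move: m_bad; rewrite mn mul2n odd_double /=.
by rewrite double_gt0 n_gt0.
Qed.

Definition u : {fps rat} :=
  2^-1 * fps_divXn 2 (1 - 2 * fpsX ^+ 2 - fps_sqrt (1 - 4 * fpsX ^+ 2)).

Section USeries.

Let disc : {fps rat} := 1 - 4 * fpsX ^+ 2.

Let fcoef_disc n : fcoef disc n = (n == 0%N)%:R - (n == 2%N)%:R * 4.
Proof.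
rewrite /disc fcoefB fcoef1 mulrC fcoefXnM fcoefMn fcoef1.
by case: n => [|[|[|n]]] //=; rewrite ?mul0r ?mul0rn ?mul1r.
Qed.

Let fcoef_sqrt1 : fcoef (fps_sqrt disc) 1 = 0.
Proof. by rewrite fcoef_sqrtS big_ord0 fcoef_disc. Qed.

Let fcoef_sqrt2 : fcoef (fps_sqrt disc) 2 = - 2.
Proof.
by rewrite fcoef_sqrtS big_ord_recl big_ord0 fcoef_sqrt1 fcoef_disc.
Qed.

Lemma uE : 2 * fpsX ^+ 2 * u = 1 - 2 * fpsX ^+ 2 - fps_sqrt (1 - 4 * fpsX ^+ 2).
Proof.
have U2 : (2 : {fps rat}) \is a GRing.unit by [].
rewrite /u mulrACA divrr // mul1r fps_divXnK // => -[|[|//]] _.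
  by rewrite !fcoefB mulrC fcoefXnM fcoef_sqrt0 fcoef1 subr0 subrr.
by rewrite !fcoefB mulrC fcoefXnM fcoef_sqrt1 fcoef1 !subr0.
Qed.

Lemma fcoef_u0 : fcoef u 0 = 0.
Proof.
rewrite /u fcoefM big_ord_recl big_ord0 addr0 subn0.
rewrite -[fcoef (fps_divXn _ _) _]/(fcoef _ 2) !fcoefB fcoef_sqrt2.
rewrite [2 * fpsX ^+ 2]mulrC fcoefXnM fcoefMn !fcoef1.
by rewrite [X in _ * X](_ : _ = 0) ?mulr0.
Qed.

Lemma unit_1Bu k : (0 < k)%N -> 1 - u ^+ k \is a GRing.unit.
Proof.
case: k => // k _; rewrite fps_unitE fcoefB exprS fcoefM big_ord_recl big_ord0.
by rewrite fcoef_u0 mul0r addr0 ?subr0 fcoef1 unitr1.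
Qed.

Lemma unit_1Du : 1 + u \is a GRing.unit.
Proof. by rewrite fps_unitE fcoefD fcoef_u0 addr0 fcoef1 unitr1. Qed.

End USeries.

(* Main.v *)
(* A strict left to right maximum of height d is the first visit of the path
   to height d when a down step follows it.  Hence Tot is the sum over d >= 1 of
   the generating functions of the Dyck paths that turn at their first visit to
   d; solving the linear recurrences by first step gives
   u^d (1 - u) / (1 - u^(d+1)) for each of them.  Writing H_r for the
   generating function of the paths of maximal height r and T_r = \sum_(s >= r) H_s,
   one has T_r = (1 + u) u^r (1 - u) / (1 - u^(r+1)), and Abel summation turns the
   series of the theorem into this sum, up to a remainder of order u^M. *)
Require Import Defs.
From mathcomp Require Import all_boot all_order all_algebra.
From mathcomp Require Import zify ring.

Import Order.TTheory GRing.Theory.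
Local Open Scope ring_scope.

(** * The quadratic equation of [u] and a square root of [u] *)

Local Notation X := (fpsX : {fps rat}).

Lemma fcoefXM0 (p : {fps rat}) : fcoef (X * p) 0 = 0.
Proof. by rewrite -[X]expr1 fcoefXnM. Qed.

Lemma fcoefXMS (p : {fps rat}) n : fcoef (X * p) n.+1 = fcoef p n.
Proof. by rewrite -[X]expr1 fcoefXnM subn1. Qed.

Lemma fpsXn_inj k : injective (fun p : {fps rat} => X ^+ k * p).
Proof.
move=> p q /= eq_pq; apply/fpsP => n.
have := congr1 (fun s => fcoef s (n + k)) eq_pq.
by rewrite !fcoefXnM ltnNge leq_addl addnK.
Qed.

(** Squaring the square root expressed through [u] gives this equation multiplied by [4 * X ^+ 2],
    which is then cancelled. *)
Lemma u_quadratic : u = X ^+ 2 * (1 + u) ^+ 2.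
Proof.
have sq : fps_sqrt (1 - 4 * X ^+ 2) ^+ 2 = 1 - 4 * X ^+ 2.
  apply: fps_sqrtK => //.
  by rewrite fcoefB mulrC fcoefXnM fcoef1 subr0.
have sE : fps_sqrt (1 - 4 * X ^+ 2) = 1 - 2 * X ^+ 2 - 2 * X ^+ 2 * u.
  by rewrite uE; ring.
have U4 : (4 : {fps rat}) \is a GRing.unit by [].
apply: (@fpsXn_inj 2); apply: (mulrI U4).
move: sq; rewrite sE => sq; apply: subr0_eq.
by rewrite -[RHS](subrr (1 - 4 * X ^+ 2)) -{2}sq; ring.
Qed.

(** Generating function of first passages one level down: a Dyck path, counted by [1 + u], then a
    down step. *)
Definition y : {fps rat} := X * (1 + u).

Lemma y2 : y ^+ 2 = u.
Proof. by rewrite exprMn -u_quadratic. Qed.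

Lemma fcoef_unM k (p : {fps rat}) n : (n < k)%N -> fcoef (u ^+ k * p) n = 0.
Proof.
move=> lt_nk; rewrite -y2 -exprM exprMn -mulrA fcoefXnM.
by rewrite (leq_trans lt_nk) // leq_pmull.
Qed.

(** * Counting words by their first step, and the generating functions *)

Fixpoint completes (h : nat) (w : seq bool) : bool :=
  match w with
  | [::] => h == 0%N
  | true :: w' => completes h.+1 w'
  | false :: w' => if h is h'.+1 then completes h' w' else false
  end.

(* The first visit of w to height d (above its start) is followed by a down
   step of w. *)
Fixpoint turns_at (d : nat) (w : seq bool) : bool :=
  match w with
  | [::] => false
  | b :: w' => if d is d'.+1 then turns_at (if b then d' else d.+1) w' else ~~ b
  end.

Definition nb_words (m : nat) (P : pred (seq bool)) : nat :=
  \sum_(w : m.-tuple bool) P w.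

Lemma nb_words0 P : nb_words 0 P = P [::].
Proof.
rewrite /nb_words (bigD1 [tuple]) //= big1 ?addn0 // => w.
by case/eqP; apply: tuple0.
Qed.

Lemma eq_nb_words m P Q : P =1 Q -> nb_words m P = nb_words m Q.
Proof. by move=> PQ; apply: eq_bigr => w _; rewrite PQ. Qed.

Lemma nb_wordsS m P :
  nb_words m.+1 P =
  (nb_words m (fun w => P (true :: w)) + nb_words m (fun w => P (false :: w)))%N.
Proof.
rewrite /nb_words.
rewrite (reindex (fun p : bool * m.-tuple bool => cons_tuple p.1 p.2)) /=.
  by rewrite -(pair_big predT predT
                 (fun b (w : m.-tuple bool) => P (b :: w) : nat)) big_bool.
exists (fun w : m.+1.-tuple bool => (thead w, [tuple of behead w])) => [[b w]|w] _.
  by congr pair; apply: val_inj.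
by case/tupleP: w => b w; apply: val_inj.
Qed.

Lemma nb_words_false m : nb_words m (fun=> false) = 0%N.
Proof. exact: big1. Qed.

(** Paths from height [h] to 0: [h] first passages down, then a Dyck path. *)
Definition completions (h : nat) : {fps rat} := y ^+ h * (1 + u).

Lemma completions0 : completions 0 = 1 + X * completions 1.
Proof. by rewrite /completions {1}u_quadratic /y; ring. Qed.

Lemma completionsS h :
  completions h.+1 = X * (completions h + completions h.+2).
Proof.
rewrite /completions !exprS; have := y2; rewrite expr2 => yy.
rewrite [y * (y * _)]mulrA yy /y; ring.
Qed.

Lemma fcoef_completions m h :
  fcoef (completions h) m = (nb_words m (completes h))%:R.
Proof.
elim: m h => [|m IHm] [|h].
- by rewrite nb_words0 completions0 fcoefD fcoefXM0 fcoef1 addr0.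
- by rewrite nb_words0 completionsS fcoefXM0.
- by rewrite nb_wordsS completions0 fcoefD fcoefXMS fcoef1 add0r IHm nb_words_false addn0.
by rewrite nb_wordsS completionsS fcoefXMS fcoefD !IHm natrD addrC.
Qed.

(* Paths from height h to 0 that turn at their first visit to height h + d; for
   h = d = 0 the formula gives 1 instead of 0. *)
Definition turning (h d : nat) : {fps rat} :=
  y ^+ h * u ^+ d * (1 - u ^+ h.+1) / (1 - u ^+ (h + d).+1).

Lemma turning_top h : turning h.+1 0 = X * completions h.
Proof.
rewrite /turning /completions addn0 mulr1 mulrK ?unit_1Bu // exprS /y; ring.
Qed.

Lemma turning0 d : turning 0 d.+1 = X * turning 1 d.
Proof.
rewrite /turning add0n add1n mulrA; congr (_ / _).
rewrite [u ^+ d.+1]exprS {1}u_quadratic /y; ring.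
Qed.

(** All three terms aim at the same level, so they share their denominator and only the numerators
    have to be compared. *)
Lemma turningS h d :
  turning h.+1 d.+1 = X * (turning h.+2 d + turning h d.+2).
Proof.
rewrite /turning !addSn !addnS -mulrDl mulrA; congr (_ / _).
have yy : y * y = u by rewrite -expr2 y2.
have Xu : X * (1 + u) = y by [].
rewrite !exprS [y * (y * _)]mulrA yy.
set U := u ^+ h; set V := u ^+ d; set Y := y ^+ h.
(* One factor [y] is traded for [X * (1 + u)], after which the identity is polynomial. *)
have -> : y * Y * (u * V) * (1 - u * (u * U)) =
    Y * V * u * (1 - u * (u * U)) * (X * (1 + u)) by rewrite Xu; ring.
ring.
Qed.

Lemma fcoef_turning m h d : (0 < h + d)%N ->
  fcoef (turning h d) m =
  (nb_words m (fun w => completes h w && turns_at d w))%:R.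
Proof.
elim: m h d => [|m IHm] [|h] [|d] // hd_gt0.
- by rewrite nb_words0 turning0 fcoefXM0 andbF.
- by rewrite nb_words0 turning_top fcoefXM0 andbF.
- by rewrite nb_words0 turningS fcoefXM0 andbF.
- by rewrite nb_wordsS turning0 fcoefXMS IHm //= nb_words_false addn0.
- rewrite nb_wordsS turning_top fcoefXMS fcoef_completions /=; congr _%:R.
  (* Already at the target level, the path must step down and may then continue by any
     completion. *)
  rewrite [X in (X + _)%N](_ : _ = 0%N) ?add0n; last first.
    by rewrite -(nb_words_false m); apply: eq_nb_words => w; rewrite andbF.
  by apply: eq_nb_words => w; rewrite /= andbT.
by rewrite nb_wordsS turningS fcoefXMS fcoefD !IHm ?addnS //= natrD.
Qed.

(** * Heights, first visits and strict left to right maxima *)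

Lemma height0 w : height w 0 = 0.
Proof. by rewrite /height take0. Qed.

Lemma height_cons b w k :
  height (b :: w) k.+1 = (if b then 1 else -1) + height w k.
Proof. by rewrite /height /=; case: b => /=; lia. Qed.

Lemma heightS w k : (k < size w)%N ->
  height w k.+1 = height w k + (if nth true w k then 1 else -1).
Proof.
move=> lt_kw; rewrite /height (take_nth true) // -cats1 !count_cat /=.
by case: (nth _ _ _) => /=; lia.
Qed.

Lemma height_le w k : height w k <= k%:Z.
Proof.
have : (count_mem true (take k w) <= k)%N.
  by rewrite (leq_trans (count_size _ _)) // size_take_min geq_minl.
by rewrite /height; lia.
Qed.

Lemma completesP h w :
  reflect ((forall k, (k <= size w)%N -> 0 <= h%:Z + height w k)
           /\ h%:Z + height w (size w) = 0)
          (completes h w).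
Proof.
apply: (iffP idP).
- elim: w h => [|b w IHw] h /=.
    by move=> /eqP->; split=> // k; rewrite leqn0 => /eqP->.
  case: b => [/IHw [ge0 end0]|]; last case: h => // h /IHw [ge0 end0].
    split=> [[|k] le_kw|]; rewrite ?height0 ?height_cons; [lia| |lia].
    by have := ge0 k le_kw; lia.
  split=> [[|k] le_kw|]; rewrite ?height0 ?height_cons; [lia| |lia].
  by have := ge0 k le_kw; lia.
elim: w h => [|b w IHw] h [ge0 end0] /=.
  by move: end0; rewrite height0 addr0; lia.
have ge0S k : (k <= size w)%N -> 0 <= h%:Z + ((if b then 1 else -1) + height w k).
  by move=> le_kw; rewrite -height_cons ge0.
rewrite /= height_cons in end0; case: b ge0S end0 {ge0} => ge0 end0.
  by apply: IHw; split=> [k /ge0|]; lia.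
case: h ge0 end0 => [|h] ge0 end0; first by have := ge0 0%N isT; rewrite height0; lia.
by apply: IHw; split=> [k /ge0|]; lia.
Qed.

Lemma dyck_completes n (w : (2 * n).-tuple bool) : dyck w = completes 0 w.
Proof.
have sz : (count_mem true w + count_mem false w = 2 * n)%N.
  rewrite -[RHS](size_tuple w) -(count_predC (pred1 true)).
  by congr addn; apply: eq_count => -[].
have hsz : height w (size w) = (count_mem true w)%:Z - (count_mem false w)%:Z.
  by rewrite /height take_size.
apply/and3P/completesP => [[/eqP nt /eqP nf /forallP ge0]|[ge0 end0]].
  split=> [k|]; last by rewrite hsz nt nf; lia.
  by rewrite size_tuple -ltnS add0r => lt_k; have := ge0 (Ordinal lt_k).
rewrite add0r hsz in end0; split; [lia|lia|].
apply/forallP => k; have := ge0 k; rewrite add0r.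
by apply; rewrite size_tuple -ltnS.
Qed.

Lemma completes_even w : completes 0 w -> ~~ odd (size w).
Proof.
move=> /completesP[_]; rewrite add0r /height take_size.
rewrite -(count_predC (pred1 true) w).
rewrite (@eq_count _ (predC (pred1 true)) (pred1 false)); last by case.
by move=> /eqP; rewrite subr_eq0 => /eqP [->]; rewrite oddD addbb.
Qed.

(** The default [true] excludes the end of the word, where no down step follows. *)
Definition first_visit_down (d : nat) (w : seq bool) (k : nat) : bool :=
  [&& height w k == d%:Z, ~~ nth true w k & [forall j : 'I_k, height w j < d%:Z]].

Lemma first_visit_down_cons d b w k :
  first_visit_down d.+1 (b :: w) k.+1
  = first_visit_down (if b then d else d.+2) w k.
Proof.
rewrite /first_visit_down /=; congr [&& _, _ & _].
  by rewrite height_cons; case: b; lia.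
apply/forallP/forallP => H j.
  have := H (lift ord0 j); rewrite /= /bump add1n height_cons.
  by case: b {H} => /=; lia.
case: (unliftP ord0 j) => [i|] ->; last by rewrite height0.
by have := H i; rewrite /= /bump add1n height_cons; case: b {H} => /=; lia.
Qed.

Lemma sum_first_visit_down d w :
  (\sum_(k < size w) first_visit_down d w k)%N = turns_at d w.
Proof.
elim: w d => [|b w IHw] d; first by rewrite big_ord0.
rewrite big_ord_recl; case: d => [|d].
  rewrite big1 => [|k _].
    rewrite addn0 /first_visit_down height0 eqxx /=.
    by case: forallP => [_|[]]; rewrite ?andbT // => -[].
  rewrite /first_visit_down; case: forallP => [/(_ ord0)|]; last by rewrite !andbF.
  by rewrite height0.
rewrite {1}/first_visit_down height0 add0n /= -IHw.
by apply: eq_bigr => k _; rewrite first_visit_down_cons.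
Qed.

(** Extends the comparison from earlier peaks to all earlier points: a point reached by a down step
    lies below its predecessor, and one reached by an up step is handled by [climb]. *)
Lemma lr_max_below w k : (0 < height w k) -> strict_lr_max w k ->
  forall j, (j < k)%N -> height w j < height w k.
Proof.
move=> hk_gt0 /andP[/and4P[k_gt0 lt_kw up_k down_k] /forallP ltpk].
have hk : height w k = height w k.-1 + 1.
  by rewrite -{1}(prednK k_gt0) heightS ?(set_nth_default false) ?up_k //; lia.
(* After an up step to height at least that of k, the absence of such a peak
     before k forces the path to climb until k.-1, above the height of k.-1. *)
have climb j : (0 < j)%N -> (j < k)%N -> nth true w j.-1 -> height w j < height w k.
  move=> j_gt0 lt_jk up_j; rewrite ltNge; apply/negP => le_hj.
  have [n] := ubnP (k - j).
  elim: n j j_gt0 lt_jk up_j le_hj => // n IHn j j_gt0 lt_jk up_j le_hj lt_n.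
  have lt_jw : (j < size w)%N by apply: ltn_trans lt_kw.
  have hjS := heightS _ _ lt_jw.
  have up : nth true w j.
    apply/negPn/negP => down; have := ltpk (Ordinal lt_jk).
    rewrite /peak /= j_gt0 lt_jw down andbT (set_nth_default true) ?up_j; last lia.
    by rewrite /= ltNge le_hj.
  rewrite up in hjS; have lt_jSk : (j.+1 < k)%N.
    rewrite ltn_neqAle lt_jk andbT; apply/eqP => jk.
    by move: hk le_hj; rewrite -jk /=; lia.
  by apply: (IHn j.+1) => //; lia.
elim=> [|j IHj] lt_jk; first by rewrite height0.
have [up|down] := boolP (nth true w j); first exact: climb.
have := IHj (ltnW lt_jk); rewrite heightS ?(negbTE down); first by lia.
by apply: ltn_trans lt_kw; apply: ltnW.
Qed.

(** A down step into [k] would put the path at height [d + 1] earlier, so a first visit followed by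
    a down step is a peak; the converse is [lr_max_below]. *)
Lemma first_visit_down_lr_max d w k :
  (forall j, (j <= size w)%N -> 0 <= height w j) ->
  (0 < d)%N -> (k < size w)%N ->
  first_visit_down d w k = strict_lr_max w k && (height w k == d%:Z).
Proof.
move=> ge0 d_gt0 lt_kw; apply/and3P/andP => [[/eqP hk down /forallP below]|[lr /eqP hk]].
  split; last by apply/eqP.
  have k_gt0 : (0 < k)%N by case: (posnP k) hk => // ->; rewrite height0; lia.
  apply/andP; split; last by apply/forallP => j; apply/implyP => _; rewrite hk.
  apply/and4P; split=> //.
  have lt_pk : (k.-1 < k)%N by lia.
  have lt_pw : (k.-1 < size w)%N by lia.
  have := below (Ordinal lt_pk); rewrite /= => hp.
  rewrite (set_nth_default true) //; apply/negPn/negP => dn.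
  by have := heightS _ _ lt_pw; rewrite prednK // (negbTE dn) hk; lia.
have hk_gt0 : 0 < height w k by rewrite hk; lia.
have below := lr_max_below _ _ hk_gt0 lr.
split; [exact/eqP| |by apply/forallP => j; rewrite -hk below].
by case/andP: lr => /and4P[].
Qed.

Lemma lr_max_height_gt0 w k :
  (forall j, (j <= size w)%N -> 0 <= height w j) ->
  strict_lr_max w k -> 0 < height w k.
Proof.
move=> ge0 /andP[/and4P[k_gt0 lt_kw up_k _] _].
have lt_pw : (k.-1 < size w)%N by lia.
have := heightS _ _ lt_pw; rewrite prednK // (set_nth_default false) // up_k.
by have := ge0 k.-1 (ltnW lt_pw); lia.
Qed.

Lemma sum_turns_at w M :
  (forall j, (j <= size w)%N -> 0 <= height w j) -> (size w <= M)%N ->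
  (\sum_(1 <= d < M.+1) turns_at d w = \sum_(k < size w) strict_lr_max w k)%N.
Proof.
move=> ge0 le_wM; under eq_bigr do rewrite -sum_first_visit_down.
(* Each maximum counts only for [d] equal to its height, which is positive and at most its abscissa,
   hence at most [M]. *)
rewrite exchange_big /=; apply: eq_bigr => k _.
rewrite big_nat; under eq_bigr => d /andP[d_gt0 _].
  rewrite first_visit_down_lr_max //; over.
rewrite -big_nat; case: (boolP (strict_lr_max w k)) => [lr|_]; last by rewrite big1.
have := lr_max_height_gt0 _ _ ge0 lr; have := height_le w k.
case: (height w k) => // h le_hk h_gt0.
rewrite (bigD1_seq h) ?iota_uniq ?mem_index_iota //=; last by have := ltn_ord k; lia.
rewrite eqxx big1 // => d /negbTE ne_dh.
by apply/eqP; rewrite eqb0; lia.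
Qed.

Lemma fcoef_Tot m M : (m <= M)%N ->
  fcoef Tot m = \sum_(1 <= d < M.+1) fcoef (turning 0 d) m.
Proof.
move=> le_mM.
(* The empty path has no peak, so degree 0 follows the same formula. *)
have -> : fcoef Tot m = if odd m then 0 else (total_lr_max m./2)%:R.
  rewrite /=; case: m {le_mM} => [|m] /=; last by rewrite andbT if_neg.
  by rewrite /total_lr_max big1 // => w _; apply: eq_card0 => -[]; lia.
rewrite big_nat; under eq_bigr => d /andP[d_gt0 _] do rewrite fcoef_turning //.
rewrite -big_nat -natr_sum /nb_words exchange_big /=.
case: ifP => [m_odd|m_even].
  rewrite big1 // => w _; apply: big1 => d _.
  case: (boolP (completes 0 w)) => // /completes_even.
  by rewrite size_tuple m_odd.
have Dm : m = (2 * m./2)%N by rewrite mul2n -[LHS]odd_double_half m_even.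
move: (m./2) Dm => n Dm {m_even}; subst m; congr _%:R.
rewrite /total_lr_max big_mkcond; apply: eq_bigr => w _.
rewrite dyck_completes; case: completesP => [[ge0 _]|_]; last by rewrite big1.
rewrite sum_turns_at ?size_tuple // => [|j le_jw]; last by rewrite -[height _ _]add0r ge0 ?size_tuple.
by rewrite /nb_strict_lr_max -sum1dep_card big_mkcond.
Qed.

(** * Abel summation *)

Lemma turning0E r : turning 0 r = u ^+ r * (1 - u) / (1 - u ^+ r.+1).
Proof. by rewrite /turning mul1r. Qed.

(* The left-hand side is the generating function of the Dyck paths of maximal
   height r. *)
Lemma height_gf r :
  (1 - u) ^+ 2 * u ^+ r * (1 + u) / ((1 - u ^+ (1 + r)) * (1 - u ^+ (2 + r)))
  = (1 + u) * (turning 0 r - turning 0 r.+1).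
Proof.
have U1 := @unit_1Bu r.+1 isT; have U2 := @unit_1Bu r.+2 isT.
have := mulVr U1; have := mulVr U2.
rewrite !turning0E invrM // !exprS.
set v := u ^+ r; set d1 := (1 - u * v)^-1.
set d2 := (1 - u * (u * v))^-1 => e2 e1.
transitivity ((1 + u) * (v * (1 - u) * d1 * (d2 * (1 - u * (u * v)))
                         - u * v * (1 - u) * d2 * (d1 * (1 - u * v)))).
  by ring.
by rewrite e1 e2 !mulr1.
Qed.

Lemma turning0_ratio r :
  (1 + u) * turning 0 r.+1
    * ((1 - u ^+ (2 + r)) / ((1 + u) * (1 - u ^+ (1 + r))))
  = u * turning 0 r.
Proof.
have U1 := @unit_1Bu r.+1 isT; have U2 := @unit_1Bu r.+2 isT.
have := mulVr U2; have := mulVr unit_1Du.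
rewrite !turning0E invrM ?unit_1Du // !exprS.
set v := u ^+ r; set d1 := (1 - u * v)^-1; set d2 := (1 - u * (u * v))^-1.
set d := (1 + u)^-1 => e e2.
transitivity (u * (v * (1 - u) * d1) * (d * (1 + u)) * (d2 * (1 - u * (u * v)))).
  by ring.
by rewrite e e2 !mulr1.
Qed.

(** The bracket grows by [1 - a r] from [r] to [r.+1]; weighted by the tail
    [(1 + u) * turning 0 r.+1], this is [(1 + u) * turning 0 r.+1 - u * turning 0 r] by
    [turning0_ratio], and the multiples of [u] telescope. *)
Lemma partial_sum M
    (a := fun i => (1 - u ^+ (2 + i)) / ((1 + u) * (1 - u ^+ (1 + i)))) :
  \sum_(1 <= r < M.+2)
     (1 - u) ^+ 2 * u ^+ r * (1 + u)
       / ((1 - u ^+ (1 + r)) * (1 - u ^+ (2 + r)))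
     * (r%:R - \sum_(1 <= i < r) a i)
  = \sum_(1 <= r < M.+2) turning 0 r + u * turning 0 M.+1
    - (1 + u) * turning 0 M.+2 * (M.+1%:R - \sum_(1 <= i < M.+1) a i).
Proof.
elim: M => [|M IHM].
  by rewrite !big_nat1 big_geq // height_gf; ring.
rewrite big_nat_recr //= IHM height_gf [in RHS]big_nat_recr //=.
rewrite [\sum_(1 <= i < M.+2) a i]big_nat_recr //= -turning0_ratio -/(a M.+1).
by rewrite -(natr1 M.+1); ring.
Qed.

Theorem theorem2 :
  fpsX ^+ 2 = u / (1 + u) ^+ 2 /\
  fps_sum_from1
    (fun r : nat =>
       (1 - u) ^+ 2 * u ^+ r * (1 + u)
         / ((1 - u ^+ (1 + r)) * (1 - u ^+ (2 + r)))
       * (r%:R - \sum_(1 <= i < r)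
                   (1 - u ^+ (2 + i)) / ((1 + u) * (1 - u ^+ (1 + i)))))
    Tot.
Proof.
split; first by rewrite {1}u_quadratic mulrK // unitrX ?unit_1Du.
(* From [n.+1] terms on, both boundary terms of [partial_sum] contain a power of [u] with exponent
   above [n], so they vanish in degree [n]. *)
move=> n; exists n.+1 => -[//|M] lt_nM.
rewrite partial_sum fcoefB fcoefD !turning0E.
have small r (p q s : {fps rat}) :
    (n < r)%N -> fcoef (p * (u ^+ r * q * s)) n = 0.
  by move=> lt_nr; rewrite -[_ * q * s]mulrA mulrCA fcoef_unM.
rewrite [(1 + u) * _ * _]mulrAC !small ?subr0 ?addr0; [|lia|lia].
by rewrite fcoef_sum -fcoef_Tot //; apply: ltnW.
Qed.
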